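(* Let $m,n$ be positive integers and $f\in L^1(\mathbb{T})$ with Fourier coefficients $d(k)$, $k\in\mathbb{Z}$. Then $$D^{[4m]}_n(f)=\mathrm{Pf}^{[2m]}\Big(\prod_{s=1}^m(i_{2s}-i_{2s-1})\cdot d\big((2n+1)m-i_1-i_2-\cdots-i_{2m}\big)\Big)_{1\le i_1,\dots,i_{2m}\le 2n}.$$ In particular $D^{[4]}_n(f)=\mathrm{pf}\big((j-i)\,d(2n+1-i-j)\big)_{1\le i,j\le 2n}$.
   Context: $\mathbb{T}$ is the unit circle with normalized Haar measure, $d(k)=\int_{\mathbb{T}}f(z)z^{-k}\mathrm{d}z$. Toeplitz hyperdeterminant: $D^{[2p]}_n(f)=\mathrm{Det}^{[2p]}\big(d(i_1+\cdots+i_p-i_{p+1}-\cdots-i_{2p})\big)_{1\le i_1,\dots,i_{2p}\le n}$, with $\mathrm{Det}^{[2p]}(A):=\frac{1}{n!}\sum_{\sigma_1,\dots,\sigma_{2p}\in\mathfrak{S}_n}\prod_j\mathrm{sgn}(\sigma_j)\prod_{i=1}^nA(\sigma_1(i),\dots,\sigma_{2p}(i))$. Hyperpfaffian of an array $B$ indexed by $\{1,\dots,2n\}^{2m}$ that changes sign when $i_{2s-1},i_{2s}$ are interchanged (each $s$): with $\mathfrak{E}_{2n}=\{\sigma\in\mathfrak{S}_{2n}:\sigma(2i-1)<\sigma(2i)\}$, $\mathrm{Pf}^{[2m]}(B):=\frac{1}{n!}\sum_{\sigma_1,\dots,\sigma_m\in\mathfrak{E}_{2n}}\prod_s\mathrm{sgn}(\sigma_s)\prod_{i=1}^nB(\sigma_1(2i-1),\sigma_1(2i),\dots,\sigma_m(2i-1),\sigma_m(2i))$;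 $\mathrm{pf}$ is the ordinary Pfaffian. *)

(* Defs.v *)
From HB Require Import structures.
From mathcomp Require Import all_boot all_order all_algebra all_fingroup.
From mathcomp Require Import all_classical all_reals all_analysis.
From mathcomp Require Import complex.
Set Implicit Arguments. Unset Strict Implicit. Unset Printing Implicit Defensive.
Import Order.TTheory GRing.Theory Num.Theory.
Local Open Scope ring_scope.

(* The unit circle T, parametrised by t in [0,1] via t |-> e^{2 pi i t};
   the normalized Haar measure on T is the image of Lebesgue measure on [0,1]. *)

Definition circ (R : realType) (t : R) : R[i] :=
  Complex (cos (2 * pi * t)) (sin (2 * pi * t)).

Definition L1T (R : realType) (f : R[i] -> R[i]) : Prop :=
  (lebesgue_measure : measure _ R).-integrable `[0%R, 1%R]%classic
     (fun t => (complex.Re (f (circ t)))%:E) /\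
  (lebesgue_measure : measure _ R).-integrable `[0%R, 1%R]%classic
     (fun t => (complex.Im (f (circ t)))%:E).

Definition fourier_coef (R : realType) (f : R[i] -> R[i]) (k : int) : R[i] :=
  let g := fun t : R => f (circ t) * circ (- (k%:~R) * t) in
  Complex (Rintegral lebesgue_measure `[0%R, 1%R]%classic (fun t => complex.Re (g t)))
          (Rintegral lebesgue_measure `[0%R, 1%R]%classic (fun t => complex.Im (g t))).

(* Hyperdeterminants.  Indices 1..n are represented by i : 'I_n (value i+1);
   a 2p-tuple of indices is a function 'I_(p.*2) -> 'I_n. *)

Definition hdet (K : fieldType) (p n : nat) (A : ('I_(p.*2) -> 'I_n) -> K) : K :=
  (n`!%:R)^-1 *
  \sum_(s : {ffun 'I_(p.*2) -> 'S_n})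
     ((\prod_(j < p.*2) (-1) ^+ (s j : bool)) *
      \prod_(i < n) A (fun j => s j i)).

Definition toeplitz_hdet (K : fieldType) (p n : nat) (d : int -> K) : K :=
  hdet (fun i : 'I_(p.*2) -> 'I_n =>
          d (\sum_(j < p.*2 | (j < p)%N) ((i j).+1)%:Z
             - \sum_(j < p.*2 | (p <= j)%N) ((i j).+1)%:Z)).

(* Hyperpfaffians.  Indices 1..2n are represented by 'I_(n.*2) (value +1).
   The 1-based position 2i-1 (resp. 2i), i = 1..n, is the 0-based position
   2i' (resp. 2i'+1) with i' = i-1 : 'I_n. *)

Lemma pidx_proof (n : nat) (i : 'I_n) (b : bool) : ((i : nat).*2 + b < n.*2)%N.
Proof.
have hi := ltn_ord i.
case: b => /=; first by rewrite addn1 -doubleS leq_double.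
by rewrite addn0 ltn_double.
Qed.

Definition pidx (n : nat) (i : 'I_n) (b : bool) : 'I_(n.*2) :=
  Ordinal (pidx_proof i b).

Lemma half_ord_proof (m : nat) (k : 'I_(m.*2)) : ((k : nat)./2 < m)%N.
Proof. by rewrite ltn_half_double ltn_ord. Qed.

Definition half_ord (m : nat) (k : 'I_(m.*2)) : 'I_m := Ordinal (half_ord_proof k).

Definition Eperm (n : nat) (s : 'S_(n.*2)) : bool :=
  [forall i : 'I_n, (s (pidx i false) < s (pidx i true))%N].

(* Hyperpfaffian Pf^{[2m]}(B), B indexed by {1..2n}^{2m}.  The argument of B
   at 0-based position k (k = 2s + b, s < m, b in {0,1}) is
   sigma_s(2i+b) (0-based), i.e. sigma_{s+1}(2i-1) / sigma_{s+1}(2i) 1-based. *)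
Definition hpf (K : fieldType) (m n : nat) (B : ('I_(m.*2) -> 'I_(n.*2)) -> K) : K :=
  (n`!%:R)^-1 *
  \sum_(s : {ffun 'I_m -> 'S_(n.*2)} | [forall t, Eperm (s t)])
     ((\prod_(t < m) (-1) ^+ (s t : bool)) *
      \prod_(i < n) B (fun k : 'I_(m.*2) =>
                         s (half_ord k) (pidx i (odd k)))).

Definition pf (K : fieldType) (n : nat) (A : 'M[K]_(n.*2)) : K :=
  ((2 ^ n * n`!)%:R)^-1 *
  \sum_(s : 'S_(n.*2))
     ((-1) ^+ (s : bool) * \prod_(i < n) A (s (pidx i false)) (s (pidx i true))).

(* Main.v *)
Require Import Defs.
From HB Require Import structures.
From mathcomp Require Import all_boot all_order all_algebra all_fingroup.
From mathcomp Require Import all_classical all_reals all_analysis.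
From mathcomp Require Import complex.
From mathcomp Require Import ring zify.
Set Implicit Arguments. Unset Strict Implicit. Unset Printing Implicit Defensive.
Import Order.TTheory GRing.Theory Num.Theory.
Local Open Scope ring_scope.

(* Both sides involve only finitely many values d(k), and on a finite window
   |k| <= N any d agrees with the Fourier coefficients
   d(k) = sum_r w_r x_r ^ (-k) of a discrete measure (invert a Vandermonde
   matrix). Expanding over the points of this measure, the hyperdeterminant
   becomes a sum of (det(x_i ^ (-j)) det(x_i ^ j)) ^ (2m) and the hyperpfaffian
   a sum of m-th powers of the confluent Vandermonde determinant with rows
   x_i ^ k and k x_i ^ (k-1). Pointwise equality is then
   |Delta| ^ 4 = (confluent determinant) * (monomial). *)


(** * Splitting the 2n positions into n consecutive pairs *)

Lemma pidx_eq (n : nat) (i j : 'I_n) (b c : bool) :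
  (pidx i b == pidx j c) = (i == j) && (b == c).
Proof.
apply/eqP/andP => [/(congr1 (fun k : 'I_(n.*2) => k : nat)) /= e|[/eqP-> /eqP->]//].
have e1 := congr1 odd e; have e2 := congr1 half e.
move: e1 e2; rewrite ![(_.*2 + _)%N]addnC !oddD !odd_double !oddb !addbF => ->.
by rewrite !half_bit_double => /val_inj->.
Qed.

Lemma half_ord_pidx (n : nat) (i : 'I_n) (b : bool) : half_ord (pidx i b) = i.
Proof. by apply/val_inj; rewrite /= addnC half_bit_double. Qed.

Lemma odd_pidx (n : nat) (i : 'I_n) (b : bool) : odd (pidx i b) = b.
Proof. by rewrite /= oddD odd_double oddb. Qed.

Lemma pidx_half_ord (n : nat) (k : 'I_(n.*2)) : pidx (half_ord k) (odd k) = k.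
Proof. by apply/val_inj; rewrite /= addnC odd_double_half. Qed.

Lemma big_pidx (T : Type) (idx : T) (op : Monoid.com_law idx) (n : nat)
    (P : pred 'I_(n.*2)) (F : 'I_(n.*2) -> T) :
  \big[op/idx]_(k < n.*2 | P k) F k =
  \big[op/idx]_(i < n) \big[op/idx]_(b : bool | P (pidx i b)) F (pidx i b).
Proof.
rewrite (pair_big_dep predT (fun i b => P (pidx i b))) /=.
rewrite (reindex (fun u : 'I_n * bool => pidx u.1 u.2)) //=.
exists (fun k => (half_ord k, odd k)) => [[i b] _|k _] /=.
  by rewrite half_ord_pidx; congr pair; exact: odd_pidx.
exact: pidx_half_ord.
Qed.

Lemma big_pidx_all (T : Type) (idx : T) (op : Monoid.com_law idx) (n : nat)
    (F : 'I_(n.*2) -> T) :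
  \big[op/idx]_(k < n.*2) F k =
  \big[op/idx]_(i < n) op (F (pidx i false)) (F (pidx i true)).
Proof. by rewrite big_pidx; apply: eq_bigr => i _; rewrite big_bool Monoid.mulmC. Qed.

(** * Permutations modulo swaps inside the pairs *)

Definition swap_pairs (n : nat) (b : {ffun 'I_n -> bool}) : 'S_(n.*2) :=
  (\prod_(i < n) (if b i then tperm (pidx i false) (pidx i true) else 1))%g.

Lemma swap_pairsE (n : nat) (b : {ffun 'I_n -> bool}) (j : 'I_n) (c : bool) :
  swap_pairs b (pidx j c) = pidx j (c (+) b j).
Proof.
rewrite /swap_pairs.
have := index_enum_uniq 'I_n; have := mem_index_enum j.
move: (index_enum _) => r jr ur.
(* For the induction, the index range becomes a duplicate-free list [r]: the transpositions are
   disjoint, so pair [j] moves exactly once, when [j] is met. *)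
suff: (\prod_(i <- r) (if b i then tperm (pidx i false) (pidx i true) else 1))%g
   (pidx j c) = pidx j (c (+) ((j \in r) && b j)).
  by move=> ->; rewrite ?jr.
move: ur; elim: r c {jr} => [|i r IH] c; first by rewrite big_nil perm1 addbF.
case/andP=> nir ur; rewrite big_cons permM.
have -> : (if b i then tperm (pidx i false) (pidx i true) else 1%g) (pidx j c) =
   pidx j (c (+) ((j == i) && b j)).
  case: (eqVneq j i) => [->|ne] /=.
    by case: (b i); case: c; rewrite ?tpermL ?tpermR ?perm1.
  by case: (b i); rewrite ?perm1 ?tpermD ?addbF // pidx_eq eq_sym (negPf ne).
rewrite IH // in_cons -addbA; congr (pidx _ (_ (+) _)).
by case: (eqVneq j i) nir => [->|] //= /negPf ->; rewrite addbF.
Qed.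

Lemma sign_swap_pairs (K : pzRingType) (n : nat) (b : {ffun 'I_n -> bool}) :
  (-1) ^+ (swap_pairs b : bool) = \prod_(i < n) (-1) ^+ (b i) :> K.
Proof.
rewrite /swap_pairs (big_morph _ (@odd_permM _) (@odd_perm1 _)).
rewrite (big_morph (fun c : bool => (-1) ^+ c : K) (signr_addb _) (erefl _)).
apply: eq_bigr => i _; case: (b i); last by rewrite odd_perm1.
by rewrite odd_tperm pidx_eq andbF.
Qed.

(* Every permutation is uniquely a product of swaps inside the pairs
   (2i-1, 2i) and a permutation that is increasing on each pair. *)
Lemma sum_perm_fold (K : comPzRingType) (n : nat)
    (G : 'I_n -> 'I_(n.*2) -> 'I_(n.*2) -> K) :
  \sum_(s : 'S_(n.*2))
     (-1) ^+ (s : bool) * \prod_(i < n) G i (s (pidx i false)) (s (pidx i true)) =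
  \sum_(s : 'S_(n.*2) | Eperm s)
     (-1) ^+ (s : bool) *
     \prod_(i < n) (G i (s (pidx i false)) (s (pidx i true))
                    - G i (s (pidx i true)) (s (pidx i false))).
Proof.
(* [type s] marks the pairs on which [s] decreases; these are the pairs to swap in the factorization
   of [s]. *)
pose type (s : 'S_(n.*2)) : {ffun 'I_n -> bool} :=
  [ffun i => (s (pidx i true) < s (pidx i false))%N].
rewrite (partition_big type predT) //=.
transitivity (\sum_(b : {ffun 'I_n -> bool}) \sum_(s : 'S_(n.*2) | Eperm s)
   (-1) ^+ (s : bool) * \prod_(i < n)
     ((-1) ^+ (b i) * G i (s (pidx i (b i))) (s (pidx i (~~ b i))))).
  apply: eq_bigr => b _; rewrite (reindex_inj (mulgI (swap_pairs b))) /=.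
  apply: eq_big => s.
    rewrite -[RHS]/[forall i, _]; apply/eqP/forallP => [/ffunP H i|H].
      move/(_ i): H; rewrite !ffunE !permM !swap_pairsE /=.
      case: (b i) => //= /negbT; rewrite -leqNgt leq_eqVlt => /orP[|//].
      by rewrite val_eqE (inj_eq perm_inj) pidx_eq andbF.
    apply/ffunP => i; rewrite !ffunE !permM !swap_pairsE /=.
    by case: (b i) => /=; rewrite ?H //; apply/negbTE; rewrite -leqNgt ltnW.
  move=> _; rewrite odd_permM signr_addb sign_swap_pairs big_split /=.
  rewrite [X in X * _]mulrC -mulrA; congr (_ * (_ * _)); apply: eq_bigr => i _.
  by rewrite !permM !swap_pairsE /=.
(* For a fixed increasing [s], the signed sum over all swap patterns factors into one difference per
   pair. *)
rewrite exchange_big /=; apply: eq_bigr => s _; rewrite -mulr_sumr; congr (_ * _).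
rewrite -(bigA_distr_bigA (fun i (c : bool) =>
  (-1) ^+ c * G i (s (pidx i c)) (s (pidx i (~~ c))))).
by apply: eq_bigr => i _; rewrite big_bool /= expr1 expr0 mulN1r mul1r addrC.
Qed.

(** * Vandermonde products and their confluent limit *)

Lemma sum_perm_Vandermonde (K : comPzRingType) (n : nat) (y : 'I_n -> K) :
  \sum_(s : 'S_n) (-1) ^+ (s : bool) * \prod_(i < n) y i ^+ (s i) =
  \prod_(i < n) \prod_(j < n | (i < j)%N) (y j - y i).
Proof.
have := det_Vandermonde (\row_i y i); rewrite -det_tr.
under eq_bigr do under eq_bigr do rewrite !mxE.
move=> <-; apply: eq_bigr => s _; congr (_ * _).
by apply: eq_bigr => i _; rewrite !mxE.
Qed.


Lemma pidx_ltn (n : nat) (i j : 'I_n) (b c : bool) :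
  (pidx i b < pidx j c)%N = (i < j)%N || [&& i == j, ~~ b & c].
Proof.
rewrite -val_eqE /=; case: (ltngtP i j) => [h|h|->] /=; case: b; case: c => /=; lia.
Qed.

(** The positions after a given one are its partner, if it comes first in its pair, and both members
    of every later pair. *)
Lemma prod_pidx_ltn (K : comPzRingType) (n : nat) (i : 'I_n) (b : bool)
    (F : 'I_(n.*2) -> K) :
  \prod_(l < n.*2 | (pidx i b < l)%N) F l =
  (if b then 1 else F (pidx i true)) *
  \prod_(j < n | (i < j)%N) (F (pidx j false) * F (pidx j true)).
Proof.
rewrite big_pidx; under eq_bigr => j _ do rewrite (eq_bigl _ _ (pidx_ltn i j b)).
rewrite (bigID (fun j : 'I_n => (i < j)%N)) /= mulrC; congr (_ * _).
  rewrite (bigD1 i) /= ?ltnn // [X in _ * X]big1 ?mulr1.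
    rewrite big_mkcond big_bool !eqxx /= andbF andbT. 
    by case: b; rewrite ?mulr1.
  move=> j /andP[/negPf nij /negPf ne]; apply: big1 => c.
  by rewrite nij eq_sym ne.
apply: eq_bigr => j ij; rewrite big_mkcond big_bool /= ij /=.
exact: mulrC.
Qed.

(** The 2 by 2 alternant at the nodes [a] and [a + X] with exponents [p + 1] and [q + 1]. *)
Definition shift_alt (K : fieldType) (a : K) (p q : nat) : {poly K} :=
  a%:P ^+ p.+1 * (a%:P + 'X) ^+ q.+1 - a%:P ^+ q.+1 * (a%:P + 'X) ^+ p.+1.

(** At [X = 0] the two nodes coincide and the alternant vanishes. *)
Lemma shift_alt_divX (K : fieldType) (a : K) (p q : nat) :
  shift_alt a p q = 'X * (shift_alt a p q %/ 'X).
Proof.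
rewrite mulrC divpK // -['X]subr0 -(polyC0 K) dvdp_XsubCl /root /shift_alt.
by rewrite !hornerE subr_eq0 mulrC.
Qed.

(** The value at 0 of the quotient by [X] is the derivative of the alternant at 0. *)
Lemma shift_alt_divX_horner0 (K : fieldType) (a : K) (p q : nat) :
  (shift_alt a p q %/ 'X).[0] = (q%:R - p%:R) * a ^+ (p + q).+1.
Proof.
have := congr1 (fun u : {poly K} => u^`().[0]) (shift_alt_divX a p q).
rewrite /= derivM derivX mul1r !hornerE => <-.
rewrite /shift_alt -!rmorphXn /= derivB !derivM !derivC !deriv_exp derivD derivC derivX.
rewrite !hornerE !hornerMn !horner_exp !hornerE /=.
rewrite !mulrnAr -!exprD addSn addSn [(q + p)%N]addnC mulrBl !mulr_natl !mulrS.
by rewrite opprD addrACA subrr add0r.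
Qed.

(* Two nodes [z i] and [z i + X] per point turn the Vandermonde product into
   [X^n] times a polynomial in [X] whose value at 0 is the confluent one. *)
Lemma confluent_Vandermonde (K : fieldType) (n : nat) (z : 'I_n -> K) :
  \sum_(s : 'S_(n.*2) | Eperm s)
     (-1) ^+ (s : bool) *
     \prod_(i < n) (((s (pidx i true))%:R - (s (pidx i false))%:R)
                    * z i ^+ (s (pidx i false) + s (pidx i true)).+1) =
  \prod_(i < n) z i ^+ 2 *
  (\prod_(i < n) \prod_(j < n | (i < j)%N) (z j - z i)) ^+ 4.
Proof.
pose y (k : 'I_(n.*2)) : {poly K} :=
  (z (half_ord k))%:P + (if odd k then 'X else 0).
have yF i : y (pidx i false) = (z i)%:P by rewrite /y half_ord_pidx odd_pidx addr0.
have yT i : y (pidx i true) = (z i)%:P + 'X by rewrite /y half_ord_pidx odd_pidx.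
pose U (s : 'S_(n.*2)) i : {poly K} := shift_alt (z i) (s (pidx i false)) (s (pidx i true)) %/ 'X.
(* The four differences between nodes of pair [i] and nodes of pair [j]; at [X = 0] their product is
   [(z j - z i) ^+ 4]. The difference inside each pair is [X], whence the factor ['X^n] below. *)
pose D i j : {poly K} := ((z j)%:P - (z i)%:P) ^+ 2 *
   ((z j)%:P - (z i)%:P + 'X) * ((z j)%:P - (z i)%:P - 'X).
have VE : \prod_(k < n.*2) \prod_(l < n.*2 | (k < l)%N) (y l - y k) =
   'X^n * \prod_(i < n) \prod_(j < n | (i < j)%N) D i j.
  rewrite big_pidx_all; under eq_bigr => i _ do rewrite !prod_pidx_ltn.
  rewrite -[n in 'X^n]card_ord -prodr_const -big_split /=.
  apply: eq_bigr => i _; rewrite yF yT mul1r -mulrA -big_split /=.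
  congr (_ * _); first by ring.
  by apply: eq_bigr => j ij; rewrite !yF !yT /D; ring.
have LE : \sum_(s : 'S_(n.*2)) (-1) ^+ (s : bool) * \prod_(k < n.*2) y k ^+ (s k).+1 =
   'X^n * \sum_(s : 'S_(n.*2) | Eperm s) (-1) ^+ (s : bool) * \prod_(i < n) U s i.
  under eq_bigr do rewrite big_pidx_all /=.
  rewrite (sum_perm_fold (fun i (a b : 'I_(n.*2)) =>
     y (pidx i false) ^+ a.+1 * y (pidx i true) ^+ b.+1)) mulr_sumr.
  apply: eq_bigr => s _; rewrite mulrCA; congr (_ * _).
  rewrite -[n in 'X^n]card_ord -prodr_const -big_split /=.
  by apply: eq_bigr => i _; rewrite !yF !yT; exact: shift_alt_divX.
have hE (s : 'S_(n.*2)) : ((-1) ^+ (s : bool) * \prod_(i < n) U s i).[0] =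
   (-1) ^+ (s : bool) * \prod_(i < n) (((s (pidx i true))%:R - (s (pidx i false))%:R)
                    * z i ^+ (s (pidx i false) + s (pidx i true)).+1).
  rewrite -(rmorph_sign (@polyC K)) hornerM hornerC horner_prod; congr (_ * _).
  by apply: eq_bigr => i _; exact: shift_alt_divX_horner0.
(* Raising every exponent by one multiplies the Vandermonde sum by the product of all nodes, which
   becomes the product of the [z i ^+ 2] at [X = 0]. *)
have : 'X^n * \sum_(s : 'S_(n.*2) | Eperm s) (-1) ^+ (s : bool) * \prod_(i < n) U s i
   = 'X^n * (\prod_(k < n.*2) y k * \prod_(i < n) \prod_(j < n | (i < j)%N) D i j).
  rewrite -LE mulrCA -VE -sum_perm_Vandermonde mulr_sumr; apply: eq_bigr => s _.
  rewrite mulrCA -big_split /=; congr (_ * _); apply: eq_bigr => k _.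
  by rewrite exprS.
move/(mulfI (expf_neq0 n (negbT (polyX_eq0 K))))/(congr1 (fun u : {poly K} => u.[0])).
rewrite /= horner_sum hornerM horner_prod big_pidx_all horner_prod.
rewrite (eq_bigr _ (fun s _ => hE s)).
move=> ->; congr (_ * _).
  by apply: eq_bigr => i _; rewrite yF yT !hornerE.
rewrite -prodrXl; apply: eq_bigr => i _; rewrite horner_prod -prodrXl.
apply: eq_bigr => j _; rewrite /D !hornerE; ring.
Qed.


(** * Expansion over the points of a discrete measure *)

(** As in Andréief's identity: choose a point [rho i] for each [i], exchange the sums, and for fixed
    [rho] the sum over tuples [s] factors over the slots [j]. *)
Lemma sum_prod_mixture (K : comPzRingType) (J S T : finType) (n : nat)
    (P : pred S) (c : S -> K) (w : T -> K) (h : J -> S -> 'I_n -> T -> K) :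
  \sum_(s : {ffun J -> S} | [forall t, P (s t)])
     (\prod_j c (s j)) * \prod_(i < n) \sum_r w r * \prod_j h j (s j) i r =
  \sum_(rho : {ffun 'I_n -> T})
     (\prod_(i < n) w (rho i)) *
     \prod_j \sum_(s | P s) c s * \prod_(i < n) h j s i (rho i).
Proof.
under eq_bigr => s _ do rewrite bigA_distr_bigA mulr_sumr.
rewrite exchange_big; apply: eq_bigr => rho _ /=.
rewrite bigA_distr_big_dep mulr_sumr; apply: eq_big => s //= _.
by rewrite !big_split /= mulrCA exchange_big.
Qed.

Lemma exprz_sum (K : fieldType) (x : K) (I : Type) (r : seq I) (P : pred I)
    (F : I -> int) :
  x != 0 -> x ^ (\sum_(i <- r | P i) F i) = \prod_(i <- r | P i) x ^ F i.
Proof. by move=> x0; apply: big_morph => // k l; rewrite expfzDr. Qed.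

Lemma prod_half_const (K : comPzRingType) (p : nat) (F : bool -> K) :
  \prod_(j < p.*2) F (j < p)%N = F true ^+ p * F false ^+ p.
Proof.
rewrite -addnn big_split_ord /=; congr (_ * _).
  by rewrite -[p in RHS]card_ord -prodr_const; apply: eq_bigr => j _; rewrite ltn_ord.
rewrite -[p in RHS]card_ord -prodr_const; apply: eq_bigr => j _.
by rewrite ltnNge leq_addr.
Qed.

(** A determinant of powers of the nodes. The flag [e] is true for the first [p] index slots: they
    enter [d] with a plus sign, hence the powers of [x] with a minus sign. *)
Definition alt_pow (K : fieldType) (n : nat) (x : 'I_n -> K) (e : bool) : K :=
  \sum_(s : 'S_n) (-1) ^+ (s : bool) *
    \prod_(i < n) x i ^ (if e then - (s i).+1%:Z else (s i).+1%:Z).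

(** The determinant with rows [x i ^ k] and [k * x i ^ k] for k from 1 to 2n, expanded along pairs
    of rows: the 2 by 2 minor on columns k and l is (l - k) times the power k + l of [x i]. *)
Definition conf_alt (K : fieldType) (n : nat) (x : 'I_n -> K) : K :=
  \sum_(s : 'S_(n.*2) | Eperm s) (-1) ^+ (s : bool) *
    \prod_(i < n) (((s (pidx i true)).+1%:Z - (s (pidx i false)).+1%:Z)%:~R
       * x i ^ ((s (pidx i false)).+1%:Z + (s (pidx i true)).+1%:Z)).

Lemma toeplitz_hdet_mixture (K : fieldType) (p n : nat) (T : finType)
    (w x : T -> K) :
  (forall r, x r != 0) ->
  toeplitz_hdet p n (fun k => \sum_r w r * x r ^ (- k)) =
  (n`!%:R)^-1 * \sum_(rho : {ffun 'I_n -> T}) (\prod_(i < n) w (rho i)) *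
     (alt_pow (x \o rho) true ^+ p * alt_pow (x \o rho) false ^+ p).
Proof.
move=> x0; congr (_ * _).
under [RHS]eq_bigr => rho _ do rewrite -prod_half_const.
rewrite -(sum_prod_mixture predT (fun s : 'S_n => (-1) ^+ (s : bool)) w
  (fun (j : 'I_(p.*2)) s i r => x r ^ (if (j < p)%N then - (s i).+1%:Z else (s i).+1%:Z))).
apply: eq_big => [s|s _]; first by symmetry; apply/forallP.
congr (_ * _); apply: eq_bigr => i _; apply: eq_bigr => r _; congr (_ * _).
rewrite -exprz_sum //; congr (_ ^ _).
rewrite [RHS](bigID (fun j : 'I_(p.*2) => (j < p)%N)) /= opprB [RHS]addrC.
congr (_ + _); last first.
  by rewrite -sumrN; apply: eq_bigr => j ->.
by apply: eq_big => j; [rewrite -leqNgt|rewrite leqNgt => /negPf ->].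
Qed.

(** Both the product of differences and the power of [x r] are multiplicative over the [m] pairs of
    indices, so each pair contributes the same factor. The constant [e] will be 2n+1. *)
Lemma hpf_mixture (K : fieldType) (m n : nat) (T : finType)
    (w x : T -> K) (e : int) :
  (forall r, x r != 0) ->
  hpf (fun i : 'I_(m.*2) -> 'I_(n.*2) =>
    (\prod_(s < m) ((i (pidx s true)).+1%:Z - (i (pidx s false)).+1%:Z))%:~R
    * \sum_r w r * x r ^ (- (e * m%:Z - \sum_(k < m.*2) (i k).+1%:Z))) =
  (n`!%:R)^-1 * \sum_(rho : {ffun 'I_n -> T}) (\prod_(i < n) w (rho i)) *
     ((\prod_(i < n) x (rho i) ^ (- e)) * conf_alt (x \o rho)) ^+ m.
Proof.
move=> x0; congr (_ * _).
(* The part of the exponent that does not depend on the indices is absorbed into the weights. *)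
transitivity (\sum_(rho : {ffun 'I_n -> T})
     (\prod_(i < n) (w (rho i) * x (rho i) ^ (- (e * m%:Z)))) *
     \prod_(t < m) conf_alt (x \o rho)); last first.
  apply: eq_bigr => rho _; rewrite big_split /= -mulrA exprMn; congr (_ * (_ * _)).
    by rewrite -prodrXl; apply: eq_bigr => i _; rewrite exprnP exprz_exp mulNr.
  by rewrite prodr_const card_ord.
rewrite -(sum_prod_mixture (@Eperm n) (fun s => (-1) ^+ (s : bool))
  (fun r => w r * x r ^ (- (e * m%:Z)))
  (fun (t : 'I_m) (s : 'S_(n.*2)) i r =>
    ((s (pidx i true)).+1%:Z - (s (pidx i false)).+1%:Z)%:~R
       * x r ^ ((s (pidx i false)).+1%:Z + (s (pidx i true)).+1%:Z))).
apply: eq_bigr => s _; congr (_ * _); apply: eq_bigr => i _.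
have sE t b : s (half_ord (pidx t b)) (pidx i (odd (pidx t b))) = s t (pidx i b).
  by rewrite half_ord_pidx odd_pidx.
rewrite mulr_sumr; apply: eq_bigr => r _.
rewrite big_split /= rmorph_prod /= mulrCA -!mulrA; congr (_ * _).
rewrite mulrCA; congr (_ * _).
  by apply: eq_bigr => t _; move: (sE t true) (sE t false) => /= -> ->.
rewrite -exprz_sum // -expfzDr // opprB addrC; congr (_ ^ (_ + _)).
rewrite big_pidx_all; apply: eq_bigr => t _.
by move: (sE t true) (sE t false) => /= -> ->.
Qed.

(** * The pointwise identity between the two determinants *)

Lemma alt_pow_false (K : fieldType) (n : nat) (x : 'I_n -> K) :
  alt_pow x false =
  (\prod_(i < n) x i) * \prod_(i < n) \prod_(j < n | (i < j)%N) (x j - x i).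
Proof.
rewrite -sum_perm_Vandermonde mulr_sumr; apply: eq_bigr => s _.
by rewrite mulrCA -big_split; congr (_ * _); apply: eq_bigr => i _; rewrite -exprnP exprS.
Qed.

(* Multiplying by [x_i ^ (n+1)] reverses the exponents, which only changes the sign. *)
Lemma alt_pow_true_sqr (K : fieldType) (n : nat) (x : 'I_n -> K) :
  (forall i, x i != 0) ->
  alt_pow x true ^+ 2 * \prod_(i < n) x i ^+ (n.+1.*2) = alt_pow x false ^+ 2.
Proof.
move=> x0; pose v : 'S_n := perm rev_ord_inj.
have E : alt_pow x true * \prod_(i < n) x i ^+ n.+1 =
         (-1) ^+ (v : bool) * alt_pow x false.
  rewrite /alt_pow mulr_suml mulr_sumr [RHS](reindex_inj (mulIg v)) /=.
  apply: eq_bigr => s _; rewrite odd_permM signr_addb -[LHS]mulrA -big_split /=.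
  rewrite [RHS]mulrA [X in _ = X * _]mulrCA -signr_addb addbb mulr1.
  congr (_ * _); apply: eq_bigr => i _.
  rewrite permM permE /= exprnP -expfzDr //; congr (_ ^ _).
  have := ltn_ord (s i); lia.
move: (congr1 (fun u : K => u ^+ 2) E); rewrite !exprMn sqrr_sign mul1r => <-.
by congr (_ * _); rewrite -prodrXl; apply: eq_bigr => i _; rewrite -exprM muln2.
Qed.

Lemma conf_altE (K : fieldType) (n : nat) (x : 'I_n -> K) :
  conf_alt x = \prod_(i < n) x i ^+ 3 *
  (\prod_(i < n) \prod_(j < n | (i < j)%N) (x j - x i)) ^+ 4.
Proof.
(* One-based indices raise the total exponent by one against [confluent_Vandermonde], so the square
   of [x i] there becomes a cube. *)
under [X in _ = X * _]eq_bigr do rewrite exprS.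
rewrite big_split /= -mulrA -confluent_Vandermonde mulr_sumr.
apply: eq_bigr => s _; rewrite mulrCA -big_split; congr (_ * _).
apply: eq_bigr => i _; rewrite /= mulrCA; congr (_ * _).
  by rewrite rmorphB /= -!pmulrn !mulrS opprD addrACA subrr add0r.
by rewrite -exprS -PoszD addSn addnS.
Qed.

Lemma alt_pow_conf_alt (K : fieldType) (n : nat) (x : 'I_n -> K) :
  (forall i, x i != 0) ->
  (alt_pow x true * alt_pow x false) ^+ 2 =
  (\prod_(i < n) x i ^ (- (n.*2).+1%:Z)) * conf_alt x.
Proof.
move=> x0; have nz k : \prod_(i < n) x i ^+ k != 0.
  by apply/prodf_neq0 => i _; rewrite expf_neq0.
(* After this multiplication both sides are the fourth power of the Vandermonde product times the
   fourth powers of the [x i], as 4 = -(2n+1) + 3 + (2n+2). This fixes the constant 2n+1. *)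
apply: (mulIf (nz n.+1.*2)).
rewrite exprMn mulrAC alt_pow_true_sqr // -exprD alt_pow_false conf_altE.
rewrite exprMn [RHS]mulrAC [RHS]mulrA; congr (_ * _).
rewrite -prodrXl -!big_split /=; apply: eq_bigr => i _.
rewrite !exprnP -!expfzDr //; congr (_ ^ _); lia.
Qed.

Lemma toeplitz_hdet_hpf_mixture (K : fieldType) (m n : nat) (T : finType)
    (w x : T -> K) (d : int -> K) :
  (forall r, x r != 0) -> (forall k, d k = \sum_r w r * x r ^ (- k)) ->
  toeplitz_hdet (m.*2) n d =
    hpf (fun i : 'I_(m.*2) -> 'I_(n.*2) =>
           (\prod_(s < m) ((i (pidx s true)).+1%:Z - (i (pidx s false)).+1%:Z))%:~R
           * d (((n.*2).+1 * m)%:Z - \sum_(k < m.*2) (i k).+1%:Z)).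
Proof.
move=> x0 /funext ->; rewrite toeplitz_hdet_mixture // PoszM hpf_mixture //.
congr (_ * _); apply: eq_bigr => rho _; congr (_ * _).
rewrite -exprMn -mul2n exprM; congr (_ ^+ _).
by rewrite alt_pow_conf_alt // => i; exact: x0.
Qed.


(** * Reduction of an arbitrary [d] to a discrete measure *)

(** The nodes 1, ..., 2N+1 are distinct and nonzero in characteristic 0, so the 2N+1 values of [d]
    on the window determine weights through an invertible Vandermonde system. *)
Lemma exists_quadrature (K : numFieldType) (d : int -> K) (N : nat) :
  exists w x : 'I_(N.*2.+1) -> K, (forall r, x r != 0) /\
  forall k : int, - N%:Z <= k <= N%:Z -> d k = \sum_r w r * x r ^ (- k).
Proof.
pose x (r : 'I_(N.*2.+1)) : K := r.+1%:R.
have x0 r : x r != 0 by rewrite pnatr_eq0.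
pose V := Vandermonde N.*2.+1 (\row_r x r).
have Vu : V \in unitmx.
  rewrite unitmxE det_Vandermonde unitfE.
  apply/prodf_neq0 => i _; apply/prodf_neq0 => j ij.
  by rewrite !mxE subr_eq0 eqr_nat eqSS gtn_eqF.
(* The window is shifted to the exponents j = N - k in 0..2N; the factor [x r ^+ N] in the weights
   undoes the shift. *)
pose u := invmx V *m \col_i d (N%:Z - i%:Z).
exists (fun r => u r 0 * x r ^+ N), x; split=> // k kN.
have [j jE] : exists j : nat, N%:Z - k = j by exists `|(N%:Z - k)%R|%N; lia.
have hj : (j < N.*2.+1)%N by lia.
have /matrixP/(_ (Ordinal hj) 0) : V *m u = \col_i d (N%:Z - i%:Z) by rewrite mulKVmx.
rewrite !mxE /=; have -> : N%:Z - j%:Z = k by rewrite -jE opprB addrC subrK.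
move=> <-; apply: eq_bigr => r _; rewrite !mxE mulrC -mulrA; congr (_ * _).
by rewrite !exprnP -expfzDr // jE.
Qed.

Lemma sum_ord_succ_bounds (q n : nat) (P : pred 'I_q) (i : 'I_q -> 'I_n) :
  0 <= \sum_(j < q | P j) (i j).+1%:Z <= (q * n)%:Z.
Proof.
rewrite -(big_morph Posz PoszD (erefl _)) /= lez_nat.
apply: (@leq_trans (\sum_(j < q) n)); last by rewrite sum_nat_const card_ord.
by rewrite big_mkcond; apply: leq_sum => j _; case: (P j).
Qed.

Lemma subz_bounds (a b : int) (p q N : nat) :
  0 <= a <= p%:Z -> 0 <= b <= q%:Z -> (p + q <= N)%N -> - N%:Z <= a - b <= N%:Z.
Proof. lia. Qed.

Lemma toeplitz_hdet_hpf (K : numFieldType) (m n : nat) (d : int -> K) :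
  toeplitz_hdet (m.*2) n d =
    hpf (fun i : 'I_(m.*2) -> 'I_(n.*2) =>
           (\prod_(s < m) ((i (pidx s true)).+1%:Z - (i (pidx s false)).+1%:Z))%:~R
           * d (((n.*2).+1 * m)%:Z - \sum_(k < m.*2) (i k).+1%:Z)).
Proof.
(* The window contains all arguments of [d]: on the left, differences of two sums in [0, 4mn]; on
   the right, (2n+1)m minus such a sum. *)
have [w [x [x0 dE]]] := exists_quadrature d (m.*2.*2 * n + (n.*2.+1 * m + m.*2 * n.*2)).
have := @toeplitz_hdet_hpf_mixture _ m n _ w x _ x0 (fun k => erefl).
set d' := fun k : int => _ => E.
transitivity (toeplitz_hdet (m.*2) n d').
  congr (_ * _); apply: eq_bigr => s _; congr (_ * _); apply: eq_bigr => i _.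
  apply: dE.
  by apply: subz_bounds (sum_ord_succ_bounds _ _) (sum_ord_succ_bounds _ _) _; lia.
rewrite E; congr (_ * _); apply: eq_bigr => s _; congr (_ * _).
apply: eq_bigr => i _; congr (_ * _); symmetry; apply: dE.
apply: subz_bounds _ (sum_ord_succ_bounds _ _) _; [by apply/andP; split|lia].
Qed.

(** * The ordinary Pfaffian and the conclusion *)

(** Folding the Pfaffian sum turns each factor into [G a b - G b a], which is twice [G a b]; the
    resulting [2 ^ n] cancels against the normalization of [pf]. *)
Lemma hpf1_pf (K : numFieldType) (n : nat) (G : 'I_(n.*2) -> 'I_(n.*2) -> K) :
  (forall a b, G b a = - G a b) ->
  hpf (fun i : 'I_(1.*2) -> 'I_(n.*2) => G (i (pidx ord0 false)) (i (pidx ord0 true))) =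
  pf (\matrix_(a, b) G a b).
Proof.
move=> Ganti; rewrite /hpf /pf.
under [in RHS]eq_bigr do under eq_bigr do rewrite mxE.
rewrite (sum_perm_fold (fun=> G)) natrM invfM [X in _ = X * _]mulrC -[RHS]mulrA.
congr (_ * _).
have h2 : (2 ^ n)%:R != 0 :> K by rewrite pnatr_eq0 expn_eq0.
apply: (mulfI h2); rewrite mulVKf // mulrC.
transitivity (\sum_(s : 'S_(n.*2) | Eperm s) ((-1) ^+ (s : bool) *
   \prod_(i < n) G (s (pidx i false)) (s (pidx i true))) * (2 ^ n)%:R).
  rewrite -mulr_suml; congr (_ * _).
  pose F (s : 'S_(n.*2)) := (-1) ^+ (s : bool) *
     \prod_(i < n) G (s (pidx i false)) (s (pidx i true)).
  (* A family indexed by ['I_1] is a single permutation; distributing a one-factor product makes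
     this reindexing. *)
  transitivity (\prod_(t < 1) \sum_(s | Eperm s) F s); last by rewrite big_ord1.
  rewrite bigA_distr_big_dep.
  apply: eq_big => s // _.
  rewrite !big_ord1 /F; congr (_ * _); apply: eq_bigr => i _.
  have sE b : s (half_ord (pidx ord0 b)) (pidx i (odd (pidx (@ord0 0) b))) = s ord0 (pidx i b).
    by rewrite half_ord_pidx odd_pidx.
  by rewrite -!sE.
apply: eq_bigr => s _; rewrite -mulrA; congr (_ * _).
rewrite natrX -[n in _ ^+ n]card_ord -prodr_const -big_split /=.
by apply: eq_bigr => i _; rewrite [in RHS](Ganti (s (pidx i false))) opprK mulr_natr mulr2n.
Qed.

Theorem theorem4p2 (R : realType) (m n : nat) (f : R[i] -> R[i]) :
  (0 < m)%N -> (0 < n)%N -> L1T f ->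
  toeplitz_hdet (m.*2) n (fourier_coef f) =
    hpf (fun i : 'I_(m.*2) -> 'I_(n.*2) =>
           (\prod_(s < m) ((i (pidx s true)).+1%:Z - (i (pidx s false)).+1%:Z))%:~R
           * fourier_coef f (((n.*2).+1 * m)%:Z - \sum_(k < m.*2) (i k).+1%:Z))
  /\
  toeplitz_hdet 2 n (fourier_coef f) =
    pf (\matrix_(i < n.*2, j < n.*2)
          (((j : nat).+1%:Z - (i : nat).+1%:Z)%:~R
           * fourier_coef f ((n.*2).+1%:Z - (i : nat).+1%:Z - (j : nat).+1%:Z))).
Proof.
move=> _ _ _; split; first exact: toeplitz_hdet_hpf.
rewrite (toeplitz_hdet_hpf 1) -hpf1_pf => [|a b].
  congr (_ * _); apply: eq_bigr => s _; congr (_ * _); apply: eq_bigr => i _.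
  by rewrite big_ord1 muln1 big_pidx_all big_ord1 /= opprD addrA.
(* Antisymmetry: the difference of the indices changes sign, while the argument of [fourier_coef f]
   is symmetric. *)
rewrite -mulNr -rmorphN opprB; congr (_ * fourier_coef f _); ring.
Qed.
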